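(* Let $p,\eta>0$. There exists a real constant $C_{p,\eta}>0$ such that for every real-valued random variable $X$, $$\forall\, n\ge1,\qquad \inf_{(x_1,\ldots,x_n)\in\mathcal I_n}\big\|\bar F_{p,n}(X,x_1,\ldots,x_n)\big\|_{L^p}\le C_{p,\eta}\,\|X\|_{L^{p+\eta}}\,n^{-1}.$$
   Context: $\mathcal I_n=\{(x_1,\ldots,x_n)\in\mathbb{R}^n:\ -\infty<x_1\le x_2\le\cdots\le x_n<+\infty\}$. $\|Y\|_{L^q}=(\mathbb{E}|Y|^q)^{1/q}\in[0,+\infty]$. For a nonempty finite set $\Gamma\subset\mathbb{R}$ and $\xi\in\mathbb{R}$, let $$F_p(\xi;\Gamma)=\inf\Big\{\Big(\sum_{x\in\Gamma}\lambda_x|\xi-x|^p\Big)^{1/p}:\ \lambda_x\in[0,1],\ \sum_{x\in\Gamma}\lambda_x x=\xi,\ \sum_{x\in\Gamma}\lambda_x=1\Big\}$$ and let $\bar F_p(\xi;\Gamma)=F_p(\xi;\Gamma)$ if $\xi$ lies in the convex hull of $\Gamma$, and $\bar F_p(\xi;\Gamma)=\min_{x\in\Gamma}|\xi-x|$ otherwise. For $(x_1,\ldots,x_n)\in\mathcal I_n$, $\bar F_{p,n}(\xi,x_1,\ldots,x_n)=\bar F_p(\xi;\{x_1,\ldots,x_n\})$. *)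

(* Defs.v *)
(* MathComp / MathComp-Analysis. *)
From HB Require Import structures.
From mathcomp Require Import all_boot all_order all_algebra finmap.
From mathcomp Require Import all_classical all_reals all_analysis.

Set Implicit Arguments.
Unset Strict Implicit.
Unset Printing Implicit Defensive.

Import Order.TTheory GRing.Theory Num.Theory.
Import numFieldNormedType.Exports.

Local Open Scope classical_set_scope.
Local Open Scope ring_scope.

Section DualQuantization.
Context {R : realType}.
Implicit Types (p xi : R) (G : {fset R}).

Definition nondecreasing_grids n : set (n.-tuple R) :=
  [set x | sorted <=%R (x : seq R)].

(* Only the values of lam on G matter. *)
Definition dual_weights xi G : set (R -> R) :=
  [set lam | [/\ forall x, x \in G -> 0 <= lam x <= 1,
                 \sum_(x <- G) lam x * x = xi &
                 \sum_(x <- G) lam x = 1]].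

(* Extended-real valued, so that the infimum is +oo when xi is not a convex
   combination of the points of G. *)
Definition dual_error p xi G : \bar R :=
  ereal_inf [set ((\sum_(x <- G) lam x * `|xi - x| `^ p) `^ p^-1)%:E
            | lam in dual_weights xi G].

(* Scalars act on R by multiplication through R^o. *)
Definition convex_hull (A : set R) : set R := smallest (@convex_set R R^o) A.

(* The neutral element +oo plays no role as soon as G is nonempty. *)
Definition nearest_dist xi G : \bar R :=
  \big[Order.min/+oo%E]_(x <- G) (`|xi - x|)%:E.

Definition ext_dual_error p xi G : \bar R :=
  if xi \in convex_hull [set` G] then dual_error p xi G
  else nearest_dist xi G.

Definition ext_dual_error_grid n p xi (x : n.-tuple R) : \bar R :=
  ext_dual_error p xi [fset y | y in (x : seq R)]%fset.

End DualQuantization.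

(* Main.v *)
Require Import Defs.
From HB Require Import structures.
From mathcomp Require Import all_boot all_order all_algebra finmap.
From mathcomp Require Import all_classical all_reals all_analysis.
From mathcomp Require Import measurable_realfun.
From mathcomp Require Import zify ring lra.

Set Implicit Arguments.
Unset Strict Implicit.
Unset Printing Implicit Defensive.

Import Order.TTheory GRing.Theory Num.Theory.
Import numFieldNormedType.Exports.

Local Open Scope classical_set_scope.
Local Open Scope ring_scope.

(** The infimum is bounded by an explicit deterministic grid, which depends on
    the law of X only through a scale s > ||X||_{p+eta}.  With a = p / eta and
    m about n / 2, its points are the numbers +/- s ((m / j)^a - 1), j = 1..m:
    up to sign they are the image of a regular subdivision of [0, 1) under the companding
    function u |-> (1 - u)^(-a) - 1.

    The argument is pointwise.  If two grid points y <= z surround xi, the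
    extended error at xi is at most z - y, since all the distances involved
    are.  The derivative of (1 - u)^(-a) is a times its power 1 + 1/a, so at
    a point xi of the range of the grid this gap is at most a constant times
    (s / m) (1 + |xi| / s)^(1 + 1/a) (lemma [level_gap]).  Outside the range
    xi is not in the convex hull and the error is at most |xi|, the distance
    to the origin; there 1 + |xi| / s >= m^a, and the same bound holds.  This
    is lemma [ext_dual_error_companded].

    Since 1 + 1/a = (p + eta) / p, the p-th power of the bound is of order
    (s / m)^p (1 + |xi| / s)^(p + eta), whose integral is finite and bounded
    by a constant times (s / m)^p as soon as ||X||_{p+eta} <= s (lemma
    [Lnorm_le_of_growth]).  Letting s decrease to ||X||_{p+eta} gives the
    inequality, including when that norm is 0. *)

(** * Pointwise bounds on the extended dual quantization error *)

Section PointwiseBounds.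
Context {R : realType}.
Implicit Types (p xi a b u v M : R) (G : {fset R}).

Lemma sum_fset_delta G (f : R -> R) a :
  a \in G -> \sum_(x <- G) (x == a)%:R * f x = f a.
Proof.
move=> aG; rewrite (big_fsetD1 a)//= eqxx mul1r big_seq big1 ?addr0// => x.
by rewrite in_fsetD1 => /andP[/negbTE -> _]; rewrite mul0r.
Qed.

(** Writing xi as a barycentre of two points of the grid that surround it
    makes every distance entering the sum at most their gap. *)
Lemma dual_error_le_gap p xi G a b : 0 < p -> a \in G -> b \in G ->
  a <= xi <= b -> (dual_error p xi G <= (b - a)%:E)%E.
Proof.
move=> p0 aG bG /andP[axi xib].
have ab : a <= b by exact: le_trans xib.
have [t /andP[t0 t1] xiE] : exists2 t : R,
    0 <= t <= 1 & t * a + (1 - t) * b = xi.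
  have [ba|ba] := eqVneq a b; first by exists 0; lra.
  have ba0 : 0 < b - a by rewrite subr_gt0 lt_neqAle ba.
  exists ((b - xi) / (b - a)); last by field; rewrite gt_eqF.
  by rewrite divr_ge0 ?ler_pdivrMr ?subr_ge0// mul1r; lra.
pose lam x := t * (x == a)%:R + (1 - t) * (x == b)%:R.
have lamE f : \sum_(x <- G) lam x * f x = t * f a + (1 - t) * f b.
  under eq_bigr do rewrite /lam mulrDl -!mulrA.
  by rewrite big_split/= -!mulr_sumr !sum_fset_delta.
apply: (@le_trans _ _
    ((\sum_(x <- G) lam x * `|xi - x| `^ p) `^ p^-1)%:E).
  apply: ereal_inf_lbound; exists lam => //; split.
  - move=> x _; rewrite /lam; case: eqP => _; case: eqP => _ /=; lra.
  - by rewrite lamE.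
  - by under eq_bigr do rewrite -[lam _]mulr1; rewrite (lamE (fun=> 1)); ring.
rewrite lee_fin lamE.
have gap x : `|xi - x| <= b - a -> `|xi - x| `^ p <= (b - a) `^ p.
  by move=> h; apply: ge0_ler_powR => //; rewrite ?nnegrE ?subr_ge0// ltW.
have ha : `|xi - a| `^ p <= (b - a) `^ p by apply: gap; rewrite ler_norml; lra.
have hb : `|xi - b| `^ p <= (b - a) `^ p by apply: gap; rewrite ler_norml; lra.
rewrite [leRHS](_ : _ = ((b - a) `^ p) `^ p^-1); last first.
  by rewrite -powRrM mulfV ?gt_eqF// powRr1// subr_ge0.
apply: ge0_ler_powR; rewrite ?nnegrE ?powR_ge0//.
- by rewrite invr_ge0 ltW.
- by rewrite addr_ge0// mulr_ge0// ?powR_ge0// subr_ge0.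
- have -> : (b - a) `^ p = t * (b - a) `^ p + (1 - t) * (b - a) `^ p by ring.
  by rewrite lerD// ler_wpM2l// subr_ge0.
Qed.

Lemma nearest_dist_le xi G x : x \in G -> (nearest_dist xi G <= `|xi - x|%:E)%E.
Proof.
by move=> xG; rewrite /nearest_dist (big_fsetD1 x)//= ge_min lexx.
Qed.

Lemma ext_dual_error_ge0 p xi G : (0 <= ext_dual_error p xi G)%E.
Proof.
rewrite /ext_dual_error; case: ifP => _.
  by apply/ereal_infP => _ [lam _ <-]; rewrite lee_fin powR_ge0.
by apply: le_bigmin => // x _; rewrite lee_fin.
Qed.

Lemma ext_dual_error_le_gap p xi G a b : 0 < p -> a \in G -> b \in G ->
  a <= xi <= b -> (ext_dual_error p xi G <= (b - a)%:E)%E.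
Proof.
move=> p0 aG bG axib; rewrite /ext_dual_error; case: ifP => _.
  exact: dual_error_le_gap.
apply: le_trans (nearest_dist_le xi aG) _.
by rewrite lee_fin; move: axib => /andP[? ?]; rewrite ler_norml; lra.
Qed.

(** The same bound at a point of either sign of a symmetric grid. *)
Lemma ext_dual_error_le_gap_norm p xi G u v : 0 < p ->
  u \in G -> - u \in G -> v \in G -> - v \in G ->
  u <= `|xi| <= v -> (ext_dual_error p xi G <= (v - u)%:E)%E.
Proof.
move=> p0 uG NuG vG NvG; case: (ger0P xi) => _ uxiv.
  exact: ext_dual_error_le_gap.
have -> : v - u = - u - - v by ring.
by apply: ext_dual_error_le_gap => //; lra.
Qed.

Lemma convex_hull_sub_itv G M xi : {in G, forall x, `|x| <= M} ->
  xi \in convex_hull [set` G] -> `|xi| <= M.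
Proof.
move=> GM; rewrite inE; apply: (@smallest_sub _ _ _ [set x : R^o | `|x| <= M]).
  move=> x y t; rewrite !inE /= => xM yM.
  rewrite -[conv _ _ _]/(t%:num * (x : R) + (1 - t%:num) * (y : R)).
  have t0 : 0 <= t%:num by rewrite ge0.
  have t1 : 0 <= 1 - t%:num by rewrite subr_ge0 le1.
  apply: le_trans (ler_normD _ _) _.
  rewrite !normrM (ger0_norm t0) (ger0_norm t1).
  rewrite [leRHS](_ : M = t%:num * M + (1 - t%:num) * M); last by ring.
  by rewrite lerD// ler_wpM2l.
by move=> x /= xG; exact: GM.
Qed.

(** Beyond the grid xi is not in the convex hull, so the error is the distance
    to the nearest point. *)
Lemma ext_dual_error_outside p xi G M x : {in G, forall y, `|y| <= M} ->
  M < `|xi| -> x \in G -> (ext_dual_error p xi G <= `|xi - x|%:E)%E.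
Proof.
move=> GM Mxi xG; rewrite /ext_dual_error ifF; first exact: nearest_dist_le.
by apply/negP => /(convex_hull_sub_itv GM); rewrite leNgt Mxi.
Qed.

End PointwiseBounds.

(** * Integration *)

Section Integration.
Context d (T : measurableType d) (R : realType).

(** No measurability is needed: a simple function below f is also below g. *)
Lemma le_integral_ge0 (mu : {measure set T -> \bar R}) (f g : T -> \bar R) :
  (forall x, 0 <= f x)%E -> (forall x, f x <= g x)%E ->
  (\int[mu]_x f x <= \int[mu]_x g x)%E.
Proof.
move=> f0 fg; rewrite !ge0_integralTE//; last by move=> x; exact: le_trans (fg x).
apply: le_ereal_sup => _ [h hf <-]; exists h => // x; exact: le_trans (fg x).
Qed.

Lemma powR_1D_le (q t : R) : 0 <= q -> 0 <= t ->
  (1 + t) `^ q <= 2 `^ q * (1 + t `^ q).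
Proof.
move=> q0 t0; have mono (x y : R) : 0 <= x -> x <= y -> x `^ q <= y `^ q.
  by move=> x0 xy; apply: ge0_ler_powR; rewrite ?nnegrE//; lra.
have [t1|t1] := leP t 1.
  apply: (@le_trans _ _ (2 `^ q)); first by apply: mono; lra.
  by rewrite ler_peMr ?powR_ge0// lerDl powR_ge0.
apply: (@le_trans _ _ ((2 * t) `^ q)); first by apply: mono; lra.
by rewrite powRM// ler_wpM2l ?powR_ge0// lerDr.
Qed.

(** A pointwise growth of order q / p passes from the q-th moment of X, assumed
    to be at most s^q, to the norm of order p.  F need not be measurable. *)
Lemma Lnorm_le_of_growth (P : probability T R) (X : {RV P >-> R})
    (F : T -> \bar R) (p q s K : R) : 0 < p -> 0 < q -> 0 < s -> 0 <= K ->
  (forall w, 0 <= F w <= (K * (1 + `|X w| / s) `^ (q / p))%:E)%E ->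
  ('N[P]_(q%:E) [EFin \o X] <= s%:E)%E ->
  ('N[P]_(p%:E) [F] <= (K * 2 `^ ((q + 1) / p))%:E)%E.
Proof.
move=> p0 q0 s0 K0 FK XN.
have Xq : (\int[P]_w (`|X w| `^ q)%:E <= (s `^ q)%:E)%E.
  rewrite -poweR_EFin; under eq_integral do rewrite -poweR_EFin.
  rewrite -(@powR_Lnorm _ _ _ P (EFin \o X)) ?gt_eqF//.
  apply: gt0_ler_poweR => //; rewrite ?in_itv/= ?Lnorm_ge0 ?leey ?andbT//.
    exact: ltW.
  by rewrite lee_fin ltW.
pose c := K `^ p * 2 `^ q.
have c0 : 0 <= c by rewrite mulr_ge0 ?powR_ge0.
have mX : measurable_fun [set: T] (fun w => (`|X w| `^ q)%:E : \bar R).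
  apply/measurable_EFinP.
  apply: (@measurableT_comp _ _ _ _ _ _ (@powR R ^~ q)) => //.
  exact: measurableT_comp.
have Fp : (\int[P]_w (`|F w| `^ p) <= (c * 2)%:E)%E.
  apply: (@le_trans _ _
      (\int[P]_w (c%:E * (1 + (s `^ q)^-1%:E * (`|X w| `^ q)%:E)))%E).
    apply: le_integral_ge0 => w; first exact: poweR_ge0.
    have /andP[F0 FKw] := FK w; rewrite gee0_abs//.
    have r0 : 0 <= `|X w| / s by rewrite divr_ge0// ltW.
    apply: (@le_trans _ _ ((K * (1 + `|X w| / s) `^ (q / p))%:E `^ p)%E).
      apply: gt0_ler_poweR; rewrite ?in_itv/= ?leey ?andbT//; first exact: ltW.
      by rewrite lee_fin mulr_ge0// powR_ge0.
    rewrite poweR_EFin lee_fin powRM ?powR_ge0// -powRrM divfK ?gt_eqF//.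
    rewrite -mulrA ler_wpM2l ?powR_ge0//; apply: le_trans (powR_1D_le _ _) _ => //.
      exact: ltW.
    have sV0 : 0 <= s^-1 by rewrite invr_ge0 ltW.
    rewrite powRM// (_ : s^-1 `^ q = (s `^ q)^-1) ?[_^-1 * _]mulrC//.
    by rewrite -powR_inv1 ?(ltW s0)// -powRrM mulN1r powRN.
  have sq0 : 0 < s `^ q by exact: powR_gt0.
  have hX w : (0 <= (s `^ q)^-1%:E * (`|X w| `^ q)%:E)%E.
    by rewrite lee_fin mulr_ge0 ?powR_ge0// invr_ge0 ltW.
  rewrite ge0_integralZl//; first last.
  - by move=> w _; rewrite adde_ge0.
  - by apply: emeasurable_funD => //; exact: measurable_funeM.
  rewrite ge0_integralD//; last exact: measurable_funeM.
  rewrite ge0_integralZl//; last by rewrite lee_fin invr_ge0 ltW.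
  rewrite integral_cst//= probability_setT mul1e [(c * 2)%:E]EFinM.
  apply: lee_wpmul2l; first by rewrite lee_fin.
  rewrite (_ : 2%:E = 1%:E + 1%:E)%E; last by rewrite -EFinD.
  rewrite leeD2l//; apply: (@le_trans _ _ ((s `^ q)^-1%:E * (s `^ q)%:E)%E).
    by apply: lee_wpmul2l => //; rewrite lee_fin invr_ge0 ltW.
  by rewrite -EFinM mulVf ?gt_eqF.
rewrite unlock /=; apply: (@le_trans _ _ ((c * 2)%:E `^ p^-1)%E).
  apply: gt0_ler_poweR; rewrite ?in_itv/= ?leey ?andbT//.
  - by rewrite invr_ge0 ltW.
  - by apply: integral_ge0 => w _; exact: poweR_ge0.
  - by rewrite lee_fin mulr_ge0.
rewrite poweR_EFin lee_fin /c -mulrA.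
have -> : 2 `^ q * 2 = 2 `^ (q + 1) :> R.
  by rewrite powRD ?powRr1//; apply/implyP.
by rewrite powRM ?powR_ge0// -!powRrM mulfV ?gt_eqF// powRr1.
Qed.

End Integration.

(** * The companded grid *)

Section CompandedGrid.
Context {R : realType}.

(** A mean value bound for the power function, from 1 - e^(-z) <= z and
    ln (1 + z) <= z. *)
Lemma powR_gap (a x y : R) : 0 <= a -> 0 < x -> x <= y ->
  y `^ a - x `^ a <= a * ((y - x) / x) * y `^ a.
Proof.
move=> a0 x0 xy; have y0 : 0 < y by exact: lt_le_trans xy.
have yx0 : 0 < y / x by rewrite divr_gt0.
have lnyx : ln (y / x) <= (y - x) / x.
  have -> : y / x = 1 + (y - x) / x by field; rewrite gt_eqF.
  apply: le_ln1Dx; apply: (@lt_le_trans _ _ 0); first lra.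
  by rewrite divr_ge0 ?subr_ge0 ?(ltW x0).
(* x^a = y^a exp (- a ln (y / x)), to which 1 + z <= exp z applies. *)
have -> : x `^ a = y `^ a * expR (- (a * ln (y / x))).
  rewrite /powR !gt_eqF// -expRD; congr expR.
  by rewrite ln_div ?posrE//; ring.
have := expR_ge1Dx (- (a * ln (y / x))).
have := powR_ge0 y a.
have := ler_wpM2l a0 lnyx.
set e := expR _; set A := a * ln _; set B := a * _; set Y := y `^ a.
by move=> AB Y0 eA; nra.
Qed.

(** The j-th level (m / j)^a, for j from 1 to m, is the value of
    (1 - u)^(-a) at u = 1 - j / m. *)
Definition level (a : R) (m j : nat) : R := (m%:R / j%:R) `^ a.

(** Node of index j of the grid of scale s on the half line: index m is the
    origin and index 1 is the farthest node. *)
Definition node (s a : R) (m j : nat) : R := s * (level a m j - 1).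

(** The grid; the second part stops at index m.-1 because the origin is already
    in the first, which leaves 2m - 1 points. *)
Definition companded_nodes (s a : R) (m : nat) : seq R :=
  [seq node s a m j | j <- iota 1 m] ++ [seq - node s a m j | j <- iota 1 m.-1].

Lemma levelmm a m : (0 < m)%N -> level a m m = 1.
Proof. by move=> m0; rewrite /level divff ?powR1// pnatr_eq0 -lt0n. Qed.

(** The gap between consecutive levels is at most a constant times the power
    1 + 1/a of the lower one, divided by m. *)
Lemma level_gap a m i : 0 < a -> (0 < m)%N -> (0 < i)%N ->
  level a m i - level a m i.+1 <=
  a * 2 `^ (a + 1) / m%:R * level a m i.+1 `^ (1 + a^-1).
Proof.
move=> a0 m0 i0; rewrite /level.
have mR : 0 < m%:R :> R by rewrite ltr0n.
have iR : 1 <= i%:R :> R by rewrite ler1n.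
have i1R : i.+1%:R = i%:R + 1 :> R by rewrite -natr1.
set x := m%:R / i.+1%:R; set y := m%:R / i%:R.
have x0 : 0 < x by rewrite divr_gt0 // ltr0n.
have y0 : 0 < y by rewrite divr_gt0 // ltr0n.
have xy : x <= y by rewrite ler_pM2l// lef_pV2 ?posrE ?i1R; lra.
have -> : (x `^ a) `^ (1 + a^-1) = x `^ (a + 1).
  by rewrite -powRrM mulrDr mulr1 mulfV ?gt_eqF.
apply: le_trans (powR_gap (ltW a0) x0 xy) _.
have -> : a * ((y - x) / x) * y `^ a = a / m%:R * y `^ (a + 1).
  rewrite powRD; last by apply/implyP => _; rewrite gt_eqF.
  rewrite powRr1 ?(ltW y0)// /x /y i1R; field.
  by rewrite !gt_eqF//; lra.
have -> : a * 2 `^ (a + 1) / m%:R * x `^ (a + 1) =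
    a / m%:R * (2 * x) `^ (a + 1) by rewrite [(2 * x) `^ _]powRM ?(ltW x0)//; ring.
(* It remains to see that y <= 2 x, that is i + 1 <= 2 i. *)
rewrite ler_wpM2l ?divr_ge0 ?(ltW a0) ?(ltW mR)//.
apply: ge0_ler_powR; rewrite ?nnegrE; [lra|lra|lra|].
rewrite /x /y i1R ler_pdivrMr; last lra.
by rewrite mulrA mulrAC ler_pdivlMr; nra.
Qed.

Lemma level_le a m i j : 0 < a -> (0 < i)%N -> (i <= j)%N ->
  level a m j <= level a m i.
Proof.
move=> a0 i0 ij; have j0 : (0 < j)%N by exact: leq_trans ij.
apply: ge0_ler_powR; rewrite ?nnegrE ?divr_ge0//; first exact: ltW.
by rewrite ler_wpM2l// lef_pV2 ?posrE ?ltr0n// ler_nat.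
Qed.

Lemma discrete_ivt (f : nat -> R) (t : R) m : (0 < m)%N ->
  f m <= t -> t < f 1 -> exists i, [/\ (0 < i)%N, (i < m)%N & f i.+1 <= t <= f i].
Proof.
elim: m => // -[|m] IH _ fm ft; first by have := le_lt_trans fm ft; rewrite ltxx.
have [fmt|tfm] := leP (f m.+1) t.
  have [i [i0 im fi]] := IH isT fmt ft; exists i; split => //; exact: ltnW.
by exists m.+1; split => //; rewrite fm ltW.
Qed.

Lemma node_ge0 s a m j : 0 < s -> 0 < a -> (0 < j <= m)%N -> 0 <= node s a m j.
Proof.
move=> s0 a0 /andP[j0 jm]; have m0 : (0 < m)%N by exact: leq_trans jm.
by rewrite mulr_ge0 ?(ltW s0)// subr_ge0 -(levelmm a m0) level_le.
Qed.

Lemma mem_companded_nodes s a m j : (0 < j <= m)%N ->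
  (node s a m j \in companded_nodes s a m) /\
  (- node s a m j \in companded_nodes s a m).
Proof.
move=> /andP[j0 jm]; have m0 : (0 < m)%N by exact: leq_trans jm.
rewrite !mem_cat; split.
  by rewrite map_f// mem_iota add1n ltnS j0.
move: jm; rewrite leq_eqVlt => /predU1P[->|jm].
  rewrite {1}/node levelmm// subrr mulr0 oppr0.
  apply/orP; left; apply/mapP; exists m; first by rewrite mem_iota add1n ltnS m0/=.
  by rewrite /node levelmm// subrr mulr0.
apply/orP; right; rewrite (map_f (fun j => - node s a m j))// mem_iota add1n.
by rewrite prednK// j0.
Qed.

Lemma companded_nodes_bound s a m x : 0 < s -> 0 < a ->
  x \in companded_nodes s a m -> `|x| <= node s a m 1.
Proof.
move=> s0 a0.
have key j : (0 < j <= m)%N -> `|node s a m j| <= node s a m 1.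
  move=> jm; rewrite ger0_norm ?node_ge0//; have /andP[j0 _] := jm.
  by rewrite ler_wpM2l ?(ltW s0)// lerB// level_le.
rewrite mem_cat => /orP[] /mapP[j]; rewrite mem_iota add1n => /andP[j0 jm] ->.
  by apply: key; rewrite j0.
rewrite normrN; apply: key; rewrite j0/=.
by move: j0 jm; lia.
Qed.

(** The pointwise form of the theorem, for the grid of scale s. *)
Lemma ext_dual_error_companded (p s a xi : R) (m : nat) (G : {fset R}) :
  0 < p -> 0 < s -> 0 < a -> (0 < m)%N -> G =i companded_nodes s a m ->
  (ext_dual_error p xi G <=
   (s * ((1 + a * 2 `^ (a + 1)) / m%:R) * (1 + `|xi| / s) `^ (1 + a^-1))%:E)%E.
Proof.
move=> p0 s0 a0 m0 GE; set t := 1 + `|xi| / s; set D := a * 2 `^ (a + 1).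
have mR : 0 < m%:R :> R by rewrite ltr0n.
have D0 : 0 <= D by rewrite mulr_ge0 ?powR_ge0 ?ltW.
have xiE : `|xi| = s * (t - 1) by rewrite /t; field; rewrite gt_eqF.
have t1 : 1 <= t by rewrite lerDl divr_ge0// ltW.
have t0 : 0 <= t by exact: le_trans t1.
have Gnode j : (0 < j <= m)%N -> node s a m j \in G /\ - node s a m j \in G.
  by rewrite !GE; exact: mem_companded_nodes.
have [tl|tl|tl] := ltgtP t (level a m 1).
(* xi lies strictly inside the range: it falls between two nodes. *)
- have mt : level a m m <= t by rewrite levelmm.
  have [i [i0 im /andP[it ti]]] := discrete_ivt (f := level a m) m0 mt tl.
  have /Gnode[ui Nui] : (0 < i <= m)%N by rewrite i0 ltnW.
  have /Gnode[uj Nuj] : (0 < i.+1 <= m)%N by [].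
  apply: (@le_trans _ _ (node s a m i - node s a m i.+1)%:E).
    apply: ext_dual_error_le_gap_norm => //.
    by rewrite xiE !ler_wpM2l ?(ltW s0)// lerB.
  rewrite lee_fin /node -mulrBr -mulrA ler_wpM2l ?(ltW s0)//.
  rewrite opprB addrA subrK.
  apply: le_trans (level_gap a0 m0 i0) _; rewrite -/D.
  apply: ler_pM; rewrite ?powR_ge0 ?divr_ge0 ?(ltW mR)//.
    by rewrite ler_wpM2r ?invr_ge0 ?(ltW mR)//; lra.
  by apply: ge0_ler_powR; rewrite ?nnegrE ?powR_ge0 ?t0// addr_ge0// invr_ge0 ltW.
(* xi lies outside the range: compare with the origin. *)
- apply: (@le_trans _ _ `|xi - 0|%:E).
    have /Gnode[nm _] : (0 < m <= m)%N by rewrite m0/=.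
    apply: (@ext_dual_error_outside _ p xi G (node s a m 1)).
    + by move=> y; rewrite GE; exact: companded_nodes_bound.
    + by rewrite xiE ltr_pM2l// ltrD2r.
    + by move: nm; rewrite /node levelmm// subrr mulr0.
  have mt : m%:R <= t `^ a^-1.
    rewrite [leLHS](_ : _ = level a m 1 `^ a^-1).
      by apply: ge0_ler_powR; rewrite ?nnegrE ?powR_ge0 ?invr_ge0 ?(ltW a0) ?(ltW tl).
    by rewrite /level divr1 -powRrM mulfV ?gt_eqF// powRr1.
  rewrite lee_fin subr0 xiE -mulrA ler_wpM2l ?(ltW s0)//.
  rewrite powRD; last by apply/implyP => _; lra.
  rewrite powRr1; last lra.
  apply: (@le_trans _ _ (m%:R^-1 * (t * m%:R))).
    by rewrite mulrCA mulVf ?gt_eqF//; lra.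
  apply: ler_pM; rewrite ?invr_ge0 ?mulr_ge0 ?(ltW mR)//.
    by rewrite ler_peMl ?invr_ge0 ?(ltW mR)//; lra.
  by rewrite ler_wpM2l//; lra.
(* xi is one of the two extreme nodes. *)
- have /Gnode[n1 Nn1] : (0 < 1 <= m)%N by rewrite m0.
  apply: (@le_trans _ _ (node s a m 1 - node s a m 1)%:E).
    by apply: ext_dual_error_le_gap_norm => //; rewrite xiE tl lexx.
  by rewrite subrr lee_fin !mulr_ge0 ?powR_ge0 ?invr_ge0 ?addr_ge0 ?(ltW s0) ?(ltW mR).
Qed.

(** Repeated points pad a short list to exactly n points. *)
Lemma exists_nondecreasing_grid n (s : seq R) x0 : x0 \in s -> (size s <= n)%N ->
  exists2 x : n.-tuple R, nondecreasing_grids x & x =i s.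
Proof.
move=> x0s sn; pose l := sort <=%R (s ++ nseq (n - size s) x0).
have ln : size l == n by rewrite size_sort size_cat size_nseq subnKC.
exists (Tuple ln); first exact: (sort_sorted le_total).
move=> y; rewrite mem_sort mem_cat mem_nseq.
by apply/orP/idP => [[//|/andP[_ /eqP ->]]//|]; left.
Qed.

End CompandedGrid.

(** * The bound of order 1 / n *)

Theorem theorem5 (R : realType) (p eta : R) (p_gt0 : 0 < p) (eta_gt0 : 0 < eta) :
  exists2 C : R, 0 < C &
    forall (d : measure_display) (T : measurableType d) (P : probability T R)
           (X : {RV P >-> R}) (n : nat), (1 <= n)%N ->
      (ereal_inf [set 'N[P]_(p%:E) [(fun w => ext_dual_error_grid p (X w) x)]
                 | x in @nondecreasing_grids R n]
       <= C%:E * 'N[P]_((p + eta)%:E) [EFin \o X] * (n%:R^-1)%:E)%E.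
Proof.
pose a := p / eta; pose q := p + eta.
have a0 : 0 < a by rewrite divr_gt0.
have q0 : 0 < q by rewrite addr_gt0.
have qp : q / p = 1 + a^-1 by rewrite /q /a; field; rewrite !gt_eqF.
pose c0 := 1 + a * 2 `^ (a + 1); pose k : R := 2 `^ ((q + 1) / p).
have c00 : 0 < c0 by rewrite ltr_pwDl// mulr_ge0 ?powR_ge0 ?ltW.
have k0 : 0 < k by exact: powR_gt0.
pose C := c0 * 2 * k; have C0 : 0 < C by rewrite !mulr_gt0.
exists C => // d T P X n n0; rewrite -/q.
have nR : 0 < n%:R :> R by rewrite ltr0n.
set N := Lnorm _ _ (EFin \o X); set I := ereal_inf _.
have N0 : (0 <= N)%E by exact: Lnorm_ge0.
have main (s : R) : 0 < s -> (N <= s%:E)%E -> (I <= (C * s / n%:R)%:E)%E.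
  move=> s0 Ns; pose m := n.+1./2.
  have m0 : (0 < m)%N by rewrite half_gt0.
  have mn : (m + m.-1 <= n)%N.
    by have := odd_double_half n.+1; rewrite -/m; lia.
  have nm : (n <= m.*2)%N.
    by have := odd_double_half n.+1; rewrite -/m; lia.
  have mR : 0 < m%:R :> R by rewrite ltr0n.
  have [nm0 _] : node s a m m \in companded_nodes s a m /\
      - node s a m m \in companded_nodes s a m.
    by apply: mem_companded_nodes; rewrite m0/=.
  have [|x xs xE] := exists_nondecreasing_grid (n := n) nm0.
    by rewrite size_cat !size_map !size_iota.
  apply: ge_ereal_inf.
  exists ('N[P]_(p%:E) [(fun w => ext_dual_error_grid p (X w) x)])%E.
    by exists x.
  apply: (@le_trans _ _ (s * (c0 / m%:R) * k)%:E).
    apply: (@Lnorm_le_of_growth _ _ _ _ X _ _ _ s) => //.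
      by rewrite !mulr_ge0 ?invr_ge0 ?(ltW s0) ?(ltW c00) ?(ltW mR).
    move=> w; rewrite ext_dual_error_ge0 qp/=.
    apply: ext_dual_error_companded => // y.
    by rewrite -xE !inE.
  rewrite lee_fin /C.
  have -> : s * (c0 / m%:R) * k = (c0 * k * s) * m%:R^-1 by ring.
  have -> : c0 * 2 * k * s / n%:R = (c0 * k * s) * (2 / n%:R) by ring.
  rewrite ler_wpM2l ?mulr_ge0 ?(ltW s0) ?(ltW c00) ?(ltW k0)//.
  rewrite -[2 / _]invf_div lef_pV2 ?posrE ?divr_gt0//.
  by rewrite ler_pdivrMr// mulr_natr -mulrnA muln2 ler_nat.
(* An infinite norm makes the right-hand side infinite; a finite norm r is
   approached by the scales s = r + de, so that s > 0 even when r = 0. *)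
case: N N0 main => [r|_ _|//]; last first.
  by rewrite gt0_muley ?lte_fin// gt0_mulye ?lte_fin ?invr_gt0// leey.
rewrite lee_fin => r0 main; apply/lee_addgt0Pr => e e0.
pose de := e * n%:R / C; have de0 : 0 < de by rewrite divr_gt0 ?mulr_gt0.
apply: le_trans (main (r + de) _ _) _.
- by rewrite ltr_wpDl.
- by rewrite lee_fin lerDl ltW.
rewrite -!EFinM -EFinD lee_fin /de le_eqVlt; apply/orP; left; apply/eqP.
by field; rewrite !gt_eqF.
Qed.
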